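(* There is an infinite nonassociative extra loop $Q$ with $Z(Q) = \{1\}$.
   Context: A loop is a set with a binary operation having a two-sided identity $1$ and such that for all $a,b$ the equations $ax=b$ and $ya=b$ have unique solutions. In products, juxtaposition binds more tightly than $\cdot$. An extra loop is a loop that is both conjugacy closed and Moufang; equivalently (and this may be taken as the definition) a loop satisfying the identity $(xy\cdot z)\cdot x = x\cdot(y\cdot zx)$. The nucleus $N(Q)$ is the set of elements that associate with all pairs of elements of $Q$ in every position; the center $Z(Q)$ is the set of elements of $N(Q)$ that commute with every element of $Q$. *)

(* Defs.v *)
From Stdlib Require Export List FinFun.

Set Implicit Arguments.
Unset Strict Implicit.

Declare Scope loop_scope.
Delimit Scope loop_scope with loop.

Record Loop : Type := MkLoop {
  carrier :> Type;
  mul : carrier -> carrier -> carrier;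
  one : carrier;
  mul_one_l : forall x, mul one x = x;
  mul_one_r : forall x, mul x one = x;
  left_solve : forall a b, exists! x, mul a x = b;
  right_solve : forall a b, exists! y, mul y a = b
}.

Arguments one {l}.

Infix "*" := mul : loop_scope.
Notation "1" := one : loop_scope.
Local Open Scope loop_scope.

Definition associative_loop (Q : Loop) : Prop :=
  forall x y z : Q, (x * y) * z = x * (y * z).

Definition extra_loop (Q : Loop) : Prop :=
  forall x y z : Q, ((x * y) * z) * x = x * (y * (z * x)).

Definition nucleus (Q : Loop) (a : Q) : Prop :=
  forall x y : Q,
    (a * x) * y = a * (x * y) /\
    (x * a) * y = x * (a * y) /\
    (x * y) * a = x * (y * a).

Definition center (Q : Loop) (a : Q) : Prop :=
  nucleus a /\ forall x : Q, a * x = x * a.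

(* Main.v *)
Require Import Defs.
From Stdlib Require Import List FinFun.
From Stdlib Require Import NArith Lia Btauto.
From Stdlib Require Import FunctionalExtensionality ProofIrrelevance.

(** The loop is an extension of the additive group of a group algebra by an
    infinite elementary abelian 2-group.  Let [B] be the natural numbers under
    bitwise exclusive or, and let [V] be the group algebra of [B] over the field
    with two elements.  Put the product
    [(u, x) (v, y) = (u + x v + (1 + x)(1 + y), x + y)] on [V * B], where the
    elements [x] and [y] of [B] also stand for their images in [V].

    Associativity fails by the coboundary of [(1 + x)(1 + y)], which is
    [(1 + x)(1 + y)(1 + z)]; this is nonzero when [x], [y], [z] are independent.
    The extra law reduces to a cocycle condition on [(1 + x)(1 + y)], and that
    condition follows from [x (1 + x) = 1 + x], because [B] has exponent 2
    ([ext_loop_extra]).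

    A central element [(u, x)] must have [x] acting trivially on [V], so [x = 0];
    then [u] must be invariant under all translations of [B].  A translation
    invariant function on [B] is constant, and a constant function of finite
    support on an infinite set is zero ([translation_invariant_zero]).  This last
    step needs [B] infinite: over a finite [B], the pair of the sum of all
    elements of [B] and [0] would be central. *)

Open Scope N_scope.

(** * The group algebra *)

Definition finitely_supported (p : N -> bool) : Prop :=
  exists l : list N, forall i, p i = true -> In i l.

(** Coefficients in the field with two elements are booleans, added by [xorb]. *)
Definition group_algebra : Type := {p : N -> bool | finitely_supported p}.

Definition coef (u : group_algebra) : N -> bool := proj1_sig u.

Lemma group_algebra_ext (u v : group_algebra) :
  (forall i, coef u i = coef v i) -> u = v.
Proof.
destruct u as [p hp], v as [q hq]; simpl; intros h.
assert (e : p = q) by (apply functional_extensionality; exact h).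
subst q; f_equal; apply proof_irrelevance.
Qed.

Lemma finitely_supported_zero : finitely_supported (fun _ => false).
Proof. exists nil; discriminate. Qed.

Lemma finitely_supported_unit : finitely_supported (fun i => i =? 0).
Proof. exists (0 :: nil); intros i h; apply N.eqb_eq in h; now left. Qed.

Lemma finitely_supported_add p q :
  finitely_supported p -> finitely_supported q ->
  finitely_supported (fun i => xorb (p i) (q i)).
Proof.
intros [l hl] [m hm]; exists (l ++ m); intros i h; apply in_or_app.
destruct (p i) eqn:hp; [left; auto | right; auto].
Qed.

Lemma finitely_supported_translate x p :
  finitely_supported p -> finitely_supported (fun i => p (N.lxor i x)).
Proof.
intros [l hl]; exists (map (fun i => N.lxor i x) l); intros i h.
apply in_map_iff; exists (N.lxor i x); split; [|auto].
now rewrite N.lxor_assoc, N.lxor_nilpotent, N.lxor_0_r.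
Qed.

Definition zero : group_algebra := exist _ _ finitely_supported_zero.

Definition unit_elt : group_algebra := exist _ _ finitely_supported_unit.

Definition add (u v : group_algebra) : group_algebra :=
  exist _ _ (finitely_supported_add _ _ (proj2_sig u) (proj2_sig v)).

(** Multiplication by the basis element [x]: as [x] is its own inverse, the
    coefficient of [x u] at [i] is that of [u] at [i + x]. *)
Definition translate (x : N) (u : group_algebra) : group_algebra :=
  exist _ _ (finitely_supported_translate x _ (proj2_sig u)).

(** The product [(1 + x)(1 + y)], expanded. *)
Definition twist (x y : N) : group_algebra :=
  add (add unit_elt (translate x unit_elt))
      (translate y (add unit_elt (translate x unit_elt))).

Lemma lxor_swap a b c : N.lxor a (N.lxor b c) = N.lxor b (N.lxor a c).
Proof. now rewrite <- !N.lxor_assoc, (N.lxor_comm a b). Qed.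

Lemma lxor_cancel a b : N.lxor a (N.lxor a b) = b.
Proof. now rewrite <- N.lxor_assoc, N.lxor_nilpotent, N.lxor_0_l. Qed.

(* [sort_lxor a] moves [a] to the front of every [lxor] combination in the goal
   and cancels its repetitions; applied to all variables in turn, it brings the
   combinations to a common normal form. *)
Ltac sort_lxor a :=
  rewrite ?N.lxor_assoc;
  repeat match goal with
  | |- context [N.lxor ?b a] =>
      lazymatch b with a => fail | _ => rewrite (N.lxor_comm b a) end
  | |- context [N.lxor ?b (N.lxor a ?c)] =>
      lazymatch b with a => fail | _ => rewrite (lxor_swap b a c) end
  | _ => progress rewrite ?lxor_cancel, ?N.lxor_nilpotent, ?N.lxor_0_r,
           ?N.lxor_0_l, ?N.lxor_assoc
  end.

(** * The loop *)

Definition ext_mul (a b : group_algebra * N) : group_algebra * N :=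
  (add (add (fst a) (translate (snd a) (fst b))) (twist (snd a) (snd b)),
   N.lxor (snd a) (snd b)).

Definition ext_one : group_algebra * N := (zero, 0).

Lemma ext_mul_one_l a : ext_mul ext_one a = a.
Proof.
destruct a as [u x]; unfold ext_mul; simpl; f_equal.
apply group_algebra_ext; intros i; simpl; unfold coef.
rewrite ?N.lxor_0_r; btauto.
Qed.

Lemma ext_mul_one_r a : ext_mul a ext_one = a.
Proof.
destruct a as [u x]; unfold ext_mul; simpl; rewrite N.lxor_0_r; f_equal.
apply group_algebra_ext; intros i; simpl; unfold coef.
rewrite ?N.lxor_0_r; btauto.
Qed.

Lemma ext_left_solve a b : exists! c, ext_mul a c = b.
Proof.
destruct a as [u x], b as [w z].
exists (translate x (add (add w u) (twist x (N.lxor x z))), N.lxor x z).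
split.
- unfold ext_mul; cbn [fst snd]; rewrite lxor_cancel; f_equal.
  apply group_algebra_ext; intros i; simpl; unfold coef.
  sort_lxor z; sort_lxor x; sort_lxor i; btauto.
- intros [v y]; unfold ext_mul; cbn [fst snd]; intros [= <- <-].
  rewrite lxor_cancel; f_equal.
  apply group_algebra_ext; intros i; simpl; unfold coef.
  sort_lxor y; sort_lxor x; sort_lxor i; btauto.
Qed.

Lemma ext_right_solve a b : exists! c, ext_mul c a = b.
Proof.
destruct a as [u x], b as [w z].
exists (add (add w (translate (N.lxor x z) u)) (twist (N.lxor x z) x),
        N.lxor x z).
split.
- unfold ext_mul; cbn [fst snd]; rewrite (N.lxor_comm _ x), lxor_cancel; f_equal.
  apply group_algebra_ext; intros i; simpl; unfold coef.
  sort_lxor z; sort_lxor x; sort_lxor i; btauto.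
- intros [v y]; unfold ext_mul; cbn [fst snd]; intros [= <- <-].
  rewrite (N.lxor_comm y x), lxor_cancel; f_equal.
  apply group_algebra_ext; intros i; simpl; unfold coef.
  sort_lxor y; sort_lxor x; sort_lxor i; btauto.
Qed.

Definition ext_loop : Loop :=
  @MkLoop _ ext_mul ext_one ext_mul_one_l ext_mul_one_r
    ext_left_solve ext_right_solve.

(** The vector parts of the three elements cancel, since both sides carry the
    same translates of them.  What is left, with sums of indices taken in [B], is
    [t(x,y) + t(x+y,z) + t(x+y+z,x) = x y t(z,x) + x t(y,z+x) + t(x,y+z+x)] for
    [t(x,y) = (1 + x)(1 + y)]; expanding gives a sum of basis elements in which
    each occurs an even number of times. *)
Lemma ext_loop_extra : extra_loop ext_loop.
Proof.
intros [u x] [v y] [w z]; simpl; unfold ext_mul; cbn [fst snd]; f_equal.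
- apply group_algebra_ext; intros i; simpl; unfold coef.
  sort_lxor z; sort_lxor y; sort_lxor x; sort_lxor i; btauto.
- now rewrite !N.lxor_assoc.
Qed.

(** The associator of [(0, 1)], [(0, 2)], [(0, 4)] is [(1 + e1)(1 + e2)(1 + e4)],
    where [ek] is the basis element indexed by [k].  These indices are
    independent bits, so the coefficient at the index [0] is nonzero. *)
Lemma ext_loop_not_associative : ~ associative_loop ext_loop.
Proof.
intros h; specialize (h (zero, 1) (zero, 2) (zero, 4)).
apply (f_equal (fun a => coef (fst a) 0)) in h.
vm_compute in h; discriminate.
Qed.

(** * Infinitude and the center *)

Lemma N_not_finite : ~ Finite N.
Proof.
intros [l hl].
assert (hmax : forall i, In i l -> i <= fold_right N.max 0 l).
{ clear hl; induction l as [|a l IH]; simpl; [easy|].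
  intros i [<-|hi]; [|specialize (IH i hi)]; lia. }
specialize (hmax _ (hl (N.succ (fold_right N.max 0 l)))); lia.
Qed.

Lemma ext_loop_not_finite : ~ Finite ext_loop.
Proof.
intros [l hl]; apply N_not_finite.
exists (map (@snd group_algebra N) l); intros x.
apply (in_map (@snd group_algebra N) l (zero, x)), hl.
Qed.

Lemma translation_invariant_zero (u : group_algebra) :
  (forall x, translate x u = u) -> u = zero.
Proof.
intros h; apply group_algebra_ext; intros i; simpl.
destruct (coef u i) eqn:hi; [exfalso | reflexivity].
destruct (proj2_sig u) as [l hl]; apply N_not_finite.
exists l; intros j; apply hl.
(* The translation by [i + j] takes the coefficient at [i] to the one at [j]. *)
generalize (f_equal (fun v => coef v i) (h (N.lxor i j))); simpl.
rewrite lxor_cancel, hi; trivial.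
Qed.

Lemma ext_loop_commutant (a : ext_loop) :
  (forall b : ext_loop, mul a b = mul b a) -> a = one.
Proof.
destruct a as [u x]; simpl; intros h.
(* Commuting with the unit of the group algebra forces [x] to fix that unit. *)
assert (hx : x = 0).
{ generalize (f_equal (fun a => coef (fst a) 0) (h (unit_elt, 0))).
  simpl; unfold coef; rewrite ?N.lxor_0_r, ?N.lxor_0_l.
  intros e; apply N.eqb_eq.
  destruct (x =? 0), (proj1_sig u 0); simpl in e; congruence. }
subst x; unfold ext_one; f_equal.
apply translation_invariant_zero; intros y.
apply group_algebra_ext; intros i.
generalize (f_equal (fun a => coef (fst a) i) (h (zero, y))).
simpl; unfold coef; rewrite ?N.lxor_0_r.
destruct (proj1_sig u i), (proj1_sig u (N.lxor i y)), (i =? 0),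
  (N.lxor i y =? 0); simpl; congruence.
Qed.

Lemma center_one (Q : Loop) : center (one : Q).
Proof.
split.
- intros x y; repeat split; now rewrite ?mul_one_l, ?mul_one_r.
- intros x; now rewrite mul_one_l, mul_one_r.
Qed.

Theorem mainTheorem6 :
  exists Q : Loop,
    extra_loop Q /\
    ~ associative_loop Q /\
    ~ Finite Q /\
    (forall x : Q, center x <-> x = one).
Proof.
exists ext_loop; split; [|split; [|split]].
- exact ext_loop_extra.
- exact ext_loop_not_associative.
- exact ext_loop_not_finite.
- intros x; split.
  + intros [_ hcomm]; exact (ext_loop_commutant _ hcomm).
  + intros ->; apply center_one.
Qed.
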